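(* Let $\Omega$ be a nonempty open subset of $\mathbb{C}$. Let $\mathcal{S}_p$, $\mathcal{S}_{uc}$ and $\mathcal{S}_u$ be the sets of sequences $(f_n)\in H(\Omega)^{\mathbb{N}}$ that converge to $0$, respectively, pointwise on $\Omega$, uniformly on every compact subset of $\Omega$, and uniformly on $\Omega$. Then there exist two Banach spaces $X_1,X_2\subset H(\Omega)^{\mathbb{N}}$ (that is, vector subspaces of $H(\Omega)^{\mathbb{N}}$, each endowed with a complete norm) satisfying the following properties: (a) Both $X_1$ and $X_2$ are infinite dimensional. (b) For $i=1,2$, the norm topology of $X_i$ is stronger (i.e. finer) than the topology inherited from $H(\Omega)^{\mathbb{N}}$. (c) $X_1\setminus\{0\}\subset\mathcal{S}_p\setminus\mathcal{S}_{uc}$ and $X_2\setminus\{0\}\subset\mathcal{S}_{uc}\setminus\mathcal{S}_u$.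
   Context: $H(\Omega)$ is the complex vector space of all holomorphic functions on $\Omega$ (which is not assumed connected), endowed with the topology of uniform convergence on compact subsets of $\Omega$. $H(\Omega)^{\mathbb{N}}$ is the complex vector space (termwise operations) of all sequences of holomorphic functions on $\Omega$, endowed with the product topology. *)

(* Defs.v *)
From HB Require Import structures.
From mathcomp Require Import all_boot all_order all_algebra.
From mathcomp Require Import complex.
From mathcomp Require Import all_classical all_reals all_analysis.
Set Implicit Arguments.
Unset Strict Implicit.
Unset Printing Implicit Defensive.
Import Order.TTheory GRing.Theory Num.Theory.
Import numFieldNormedType.Exports.
Local Open Scope classical_set_scope.
Local Open Scope ring_scope.

(* The numClosedFieldType packaging is what gives R[i] the topology and the
   normed module structure (over itself) induced by the modulus. *)
Definition Cplx (R : realType) : numClosedFieldType := R[i]%C.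

Section Holomorphic.
Context {R : realType} (Omega : set (Cplx R)).

(* A function on Omega is extended by 0 in order to differentiate it; when
   Omega is open, the extension does not matter.  The increments in
   [derivable] range over Cplx R, so this is complex differentiability. *)
Definition holomorphic (f : Omega -> Cplx R) : Prop :=
  forall z : Omega, derivable ('valL_ 0 f : Cplx R -> Cplx R) (\val z) 1.

Definition holo_pred : {pred Omega -> Cplx R} := [pred f | `[< holomorphic f >]].

Lemma holo_submod : submod_closed holo_pred.
Proof.
have valLD (a : Cplx R) (f g : Omega -> Cplx R) :
    'valL_ 0 (a *: f + g) = a *: 'valL_ 0 f + 'valL_ 0 g :> (Cplx R -> Cplx R).
  apply/funext => x; rewrite /valL_ /= !fctE /=.
  by case: ('oinv_set_val x) => [y|] //=; rewrite scaler0 addr0.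
split.
- apply/asboolP => z.
  have -> : 'valL_ 0 (0 : Omega -> Cplx R) = cst 0 :> (Cplx R -> Cplx R).
    by apply/funext => x; rewrite /valL_ /=; case: ('oinv_set_val x).
  exact: derivable_cst.
- move=> a f g /asboolP hf /asboolP hg; apply/asboolP => z.
  rewrite valLD; apply: derivableD; last exact: hg.
  by apply: derivableZ; exact: hf.
Qed.

HB.instance Definition _ := GRing.isSubmodClosed.Build _ _ holo_pred holo_submod.

Record Hol := MkHol { hol_fun :> Omega -> Cplx R; _ : hol_fun \in holo_pred }.

HB.instance Definition _ := [isSub for hol_fun].
HB.instance Definition _ := [Choice of Hol by <:].
HB.instance Definition _ := [SubChoice_isSubLmodule of Hol by <:].

(* Here [compact] refers to the subtype topology of Omega: the family is that
   of all compact subsets of Cplx R contained in Omega. *)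
HB.instance Definition _ := Topological.copy Hol
  (initial_topology (hol_fun : Hol -> {family compact, Omega -> Cplx R})).

Definition S_p : set (nat -> Hol) :=
  [set f | forall z : Omega, f n z @[n --> \oo] --> (0 : Cplx R)].

Definition S_uc : set (nat -> Hol) :=
  [set f | forall K : set Omega, compact K ->
    {uniform K, (fun n => hol_fun (f n)) @ \oo --> cst 0}].

Definition S_u : set (nat -> Hol) :=
  [set f | {uniform, (fun n => hol_fun (f n)) @ \oo --> cst 0}].

End Holomorphic.
Arguments S_p {R} Omega.
Arguments S_uc {R} Omega.
Arguments S_u {R} Omega.

Definition infinite_dimensional (K : fieldType) (V : lmodType K) : Prop :=
  ~ exists (n : nat) (e : 'I_n -> V),
      forall v, exists c : 'I_n -> K, v = \sum_i c i *: e i.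

(* A vector subspace of V endowed with a complete norm, presented as a Banach
   space together with its linear inclusion into V (in the style of subType);
   the subspace itself is [carrier X]. *)
Record banachSubspace (K : numFieldType) (V : lmodType K) := BanachSubspace {
  banach_sort :> completeNormedModType K;
  banach_incl : {linear banach_sort -> V};
  banach_incl_inj : injective banach_incl }.

Definition carrier (K : numFieldType) (V : lmodType K)
  (X : banachSubspace V) : set V := range (banach_incl X).

(* The space of sequences carries the product topology {ptws nat -> _}, and
   [initial_topology] is the topology X inherits from it. *)
Definition finer_than_inherited (R : realType) (Omega : set (Cplx R))
    (X : banachSubspace (nat -> Hol Omega)) : Prop :=
  forall A : set X,
    open (A : set (initial_topology
      (banach_incl X : X -> {ptws nat -> Hol Omega}))) ->
    open A.

(* Main.v *)
Require Import Defs.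
From HB Require Import structures.
From mathcomp Require Import all_boot all_order all_algebra.
From mathcomp Require Import complex.
From mathcomp Require Import all_classical all_reals all_analysis.
From mathcomp Require Import ring lra.
Set Implicit Arguments.
Unset Strict Implicit.
Unset Printing Implicit Defensive.
Import Order.TTheory GRing.Theory Num.Theory.
Import numFieldNormedType.Exports.
Import ComplexField.Normc.
Local Open Scope classical_set_scope.
Local Open Scope ring_scope.

(** Fix one sequence (f_n) in S_p (resp. S_uc) such that every |f_n| reaches 1
    on a fixed compact set (resp. on Omega), and split the indices into
    infinitely many infinite blocks.  Multiplying the k-th block by a_k embeds
    l^oo: the products still tend to 0 since a is bounded, and if a_k <> 0, the
    convergence already fails to be uniform along the k-th block.

    For S_uc, take f_n = g / (n+1) with g unbounded on Omega: the identity, or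
    1 / (z - b) for a boundary point b.  For S_p, pole pushing yields
    polynomials P_n that are small on the disc of radius n deprived of a thin
    strip parallel to the positive real axis, and equal to 1 at a point p_n of
    this strip; the strips approach the axis without meeting it, so P_n -> 0
    pointwise, whereas p_n -> 0. *)

(** * Polynomial approximation and pole pushing *)

Section PolynomialApproximation.
Context {R : realType}.
Local Notation C := R[i].
Implicit Types (K : C -> Prop) (z q p : C) (h t u : C -> C).

Lemma normc_ge0 z : 0 <= normc z.
Proof. by case: z => a b; rewrite /= sqrtr_ge0. Qed.

Lemma normcB z q : normc (z - q) = normc (q - z).
Proof. by rewrite -opprB normcN. Qed.

Lemma le_normcB z q : normc z - normc q <= normc (z - q).
Proof. by have := le_normcD (z - q) q; rewrite subrK; lra. Qed.

Lemma normcX z n : normc (z ^+ n) = normc z ^+ n.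
Proof. by elim: n => [|n IH]; rewrite ?expr0 ?normc1// !exprS normcM IH. Qed.

Lemma normc_nat n : normc (n%:R : C) = n%:R.
Proof. by rewrite -[n%:R]/(1 *+ n) normcMn normc1. Qed.

Lemma le_Re_normc z : `|complex.Re z| <= normc z.
Proof.
case: z => a b /=; rewrite -sqrtr_sqr ler_sqrt ?lerDl ?sqr_ge0//.
by rewrite addr_ge0 ?sqr_ge0.
Qed.

Lemma le_Im_normc z : `|complex.Im z| <= normc z.
Proof.
case: z => a b /=; rewrite -sqrtr_sqr ler_sqrt ?lerDr ?sqr_ge0//.
by rewrite addr_ge0 ?sqr_ge0.
Qed.

Lemma normc_le_ReIm z : normc z <= `|complex.Re z| + `|complex.Im z|.
Proof.
case: z => a b; have -> : (a +i* b = a%:C + (0 +i* b))%C by simpc.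
by rewrite (le_trans (le_normcD _ _))//= expr0n /= !addr0 !add0r !sqrtr_sqr.
Qed.

(** Bernoulli's inequality for [x^-1] makes its powers exceed [e^-1]. *)
Lemma exprn_eventually_le (x e : R) :
  0 <= x -> x < 1 -> 0 < e -> exists n, x ^+ n <= e.
Proof.
move=> x0 x1 e0; have [->|xN0] := eqVneq x 0; first by exists 1%N; rewrite ltW.
have {xN0}x0 : 0 < x by rewrite lt_neqAle eq_sym xN0.
have bernoulli n : 1 + n%:R * (x^-1 - 1) <= x^-1 ^+ n.
  have y0 : 0 <= x^-1 - 1 by rewrite subr_ge0 invf_ge1 ?ltW.
  elim: n => [|n IH]; first by rewrite mul0r addr0.
  rewrite exprS -natr1; have : 0 <= n%:R :> R by [].
  move: (x^-1) (n%:R) (x^-1 ^+ n) y0 IH => y m Y y0 IH m0.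
  have := ler_wpM2l (_ : 0 <= y) IH; have := mulr_ge0 m0 (mulr_ge0 y0 y0); nra.
have y0 : 0 < x^-1 - 1 by rewrite subr_gt0 invf_gt1.
exists (Num.bound (e^-1 / (x^-1 - 1))).
rewrite -[x]invrK -[e]invrK exprVn lef_pV2 ?posrE ?exprn_gt0 ?invr_gt0//.
apply: le_trans (bernoulli _).
have /archi_boundP : 0 <= e^-1 / (x^-1 - 1) by rewrite divr_ge0 ?invr_ge0 ?ltW.
rewrite ltr_pdivrMr// !invrK => /ltW /le_trans; apply; by rewrite lerDr.
Qed.

(** The bound on [h] is carried along because stability under products needs it. *)
Definition polyapprox K h :=
  (exists M, forall z, K z -> normc (h z) <= M) /\
  forall e : R, 0 < e ->
    exists p : {poly C}, forall z, K z -> normc (h z - p.[z]) <= e.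

Lemma eq_polyapprox K h u : (forall z, K z -> h z = u z) ->
  polyapprox K h -> polyapprox K u.
Proof.
move=> hu [[M hM] hp]; split; first by exists M => z Kz; rewrite -hu// hM.
by move=> e /hp[p pe]; exists p => z Kz; rewrite -hu// pe.
Qed.

Lemma polyapprox_cst K c : polyapprox K (fun=> c).
Proof.
split; first by exists (normc c).
by move=> e e0; exists c%:P => z _; rewrite hornerC subrr normc0 ltW.
Qed.

Lemma polyapprox_id K (M : R) : (forall z, K z -> normc z <= M) ->
  polyapprox K id.
Proof.
move=> KM; split; first by exists M.
by move=> e e0; exists 'X => z _; rewrite hornerX subrr normc0 ltW.
Qed.

Lemma polyapproxD K h u : polyapprox K h -> polyapprox K u ->
  polyapprox K (fun z => h z + u z).
Proof.
move=> [[M hM] hp] [[N uN] up]; split.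
  by exists (M + N) => z Kz; rewrite (le_trans (le_normcD _ _))// lerD ?hM ?uN.
move=> e e0; have e20 : 0 < e / 2 by lra.
have [p pe] := hp _ e20; have [q qe] := up _ e20.
exists (p + q) => z Kz; rewrite hornerD opprD addrACA.
by rewrite (le_trans (le_normcD _ _))// [leRHS]splitr lerD ?pe ?qe.
Qed.

Lemma polyapproxM K h u : polyapprox K h -> polyapprox K u ->
  polyapprox K (fun z => h z * u z).
Proof.
move=> [[M hM] hp] [[N uN] up].
(* The extra 1 leaves room for an approximant of [u] within distance 1, which is then bounded by [B]
   too. *)
pose B := `|M| + `|N| + 1.
have B0 : 0 < B by rewrite /B; have := normr_ge0 M; have := normr_ge0 N; lra.
have {}hM z : K z -> normc (h z) <= B.
  move=> /hM /le_trans; apply; rewrite /B.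
  by have := ler_norm M; have := normr_ge0 N; lra.
have {}uN z : K z -> normc (u z) <= B - 1.
  move=> /uN /le_trans; apply; rewrite /B.
  by have := ler_norm N; have := normr_ge0 M; lra.
split.
  exists (B * B) => z Kz; rewrite normcM ler_pM ?normc_ge0 ?hM//.
  by have := uN _ Kz; lra.
move=> e e0.
have d0 : 0 < e / (2 * B) by rewrite divr_gt0 ?mulr_gt0.
have [p pe] := hp _ d0.
have [] := up (Num.min 1 (e / (2 * B))); first by rewrite lt_min ltr01.
move=> q qe; exists (p * q) => z Kz; rewrite hornerM.
have -> : h z * u z - p.[z] * q.[z] =
  h z * (u z - q.[z]) + q.[z] * (h z - p.[z]) by ring.
have := qe _ Kz; rewrite le_min => /andP[q1 q2].
have qB : normc q.[z] <= B.
  by have := le_normcB q.[z] (u z); rewrite normcB; have := uN _ Kz; lra.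
rewrite (le_trans (le_normcD _ _))// !normcM.
have -> : e = B * (e / (2 * B)) + B * (e / (2 * B)) by field; lra.
by rewrite lerD// ler_pM ?normc_ge0 ?hM ?pe.
Qed.

Lemma polyapproxX K h n : polyapprox K h -> polyapprox K (fun z => h z ^+ n).
Proof.
move=> Kh; elim: n => [|n IH]; first exact: polyapprox_cst.
by apply: eq_polyapprox (polyapproxM Kh IH) => z _; rewrite exprS.
Qed.

Lemma polyapprox_sum K (h : nat -> C -> C) n :
  (forall k, polyapprox K (h k)) -> polyapprox K (fun z => \sum_(k < n) h k z).
Proof.
move=> Kh; elim: n => [|n IH].
  by apply: eq_polyapprox (polyapprox_cst K 0) => z _; rewrite big_ord0.
by apply: eq_polyapprox (polyapproxD IH (Kh n)) => z _; rewrite big_ord_recr.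
Qed.

(** The geometric series in [t] converges uniformly on [K]. Its partial sums stay in the class, and
    the remainder after n terms is u / (1 - t) * t ^+ n. *)
Lemma polyapprox_geometric K u t : polyapprox K u -> polyapprox K t ->
  (forall z, K z -> normc (t z) <= 2^-1) ->
  polyapprox K (fun z => u z / (1 - t z)).
Proof.
move=> Ku Kt t2.
have t1 z : K z -> 2^-1 <= normc (1 - t z).
  by move=> Kz; have := le_normcB 1 (t z); rewrite normc1; have := t2 _ Kz; lra.
have t10 z : K z -> 1 - t z != 0.
  move=> Kz; apply/eqP => tz; have := t1 _ Kz; rewrite tz normc0; lra.
have [M uM] := Ku.1.
have bd z : K z -> normc (u z / (1 - t z)) <= `|M| * 2.
  move=> Kz; rewrite normcM normcV ler_pM ?normc_ge0 ?invr_ge0 ?normc_ge0//.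
    by rewrite (le_trans (uM _ Kz)) ?ler_norm.
  by rewrite -[leRHS]invrK lef_pV2 ?t1// posrE; have := t1 _ Kz; lra.
split; first by exists (`|M| * 2).
move=> e e0; have M0 := normr_ge0 M.
have [|||n ne] := @exprn_eventually_le 2^-1 (e / 2 / (`|M| * 2 + 1));
  [lra|lra| |].
  by rewrite !divr_gt0//; lra.
have [_] : polyapprox K (fun z => u z * \sum_(k < n) t z ^+ k).
  apply: polyapproxM => //.
  apply: (@polyapprox_sum _ (fun k z => t z ^+ k)) => k.
  exact: polyapproxX.
move=> /(_ (e / 2)) []; first by lra.
move=> p pe; exists p => z Kz.
have := pe _ Kz; set s := \sum_(_ < _) _.
rewrite -[u z / _](subrK (u z * s)) -addrA => se.
rewrite (le_trans (le_normcD _ _))// [leRHS]splitr lerD// {se}.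
have -> : u z / (1 - t z) - u z * s = u z / (1 - t z) * t z ^+ n.
  have : (1 - t z) * s = 1 - t z ^+ n by rewrite -opprB mulNr -subrX1 opprB.
  have := t10 _ Kz; move: (t z ^+ n) s => a s t0 E.
  have -> : a = 1 - (1 - t z) * s by rewrite E opprB addrC subrK.
  by field.
rewrite normcM normcX.
have tn : normc (t z) ^+ n <= e / 2 / (`|M| * 2 + 1).
  by rewrite (le_trans _ ne)// lerXn2r ?nnegrE ?normc_ge0 ?t2//; lra.
rewrite (@le_trans _ _ ((`|M| * 2) * (e / 2 / (`|M| * 2 + 1))))//.
  by rewrite ler_pM ?normc_ge0 ?exprn_ge0 ?normc_ge0 ?bd.
have B0 : 0 < `|M| * 2 + 1 by lra.
have d0 : 0 < e / 2 / (`|M| * 2 + 1) by rewrite !divr_gt0.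
have := divfK (lt0r_neq0 B0) (e / 2); lra.
Qed.

(* Runge's pole pushing along the horizontal half-line starting at [q]. *)
Lemma polyapprox_pole K (M s : R) q : 0 < s ->
  (forall z, K z -> normc z <= M) ->
  (forall z, K z -> forall j : nat,
    2 * s <= normc (z - (q + (j%:R * s)%:C%C))) ->
  polyapprox K (fun z => (z - q)^-1).
Proof.
move=> s0 KM Ks.
pose c j := q + (j%:R * s)%:C%C.
have cK z j : K z -> z - c j != 0.
  move=> Kz; apply/eqP => zc; have := Ks _ Kz j.
  by rewrite -/(c j) zc normc0; lra.
(* From such a far pole one can start: |z / c N| <= 1/2 on [K], so 1 / (z - c N) expands in powers
   of z. *)
have [N NM] : exists N : nat, 2 * `|M| + 1 <= normc (c N).
  pose B := (2 * `|M| + 1 + normc q) / s.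
  have B0 : 0 <= B.
    by rewrite divr_ge0 ?(ltW s0)// !addr_ge0 ?mulr_ge0 ?normc_ge0.
  exists (Num.bound B); have := archi_boundP B0.
  rewrite ltr_pdivrMr// => /ltW BN.
  have := le_normcB ((Num.bound B)%:R * s)%:C%C (- q).
  rewrite opprK normcN /c addrC.
  have := le_trans (ler_norm _) (le_Re_normc ((Num.bound B)%:R * s)%:C%C).
  by rewrite [complex.Re _]/= [q + _]addrC; lra.
(* The induction walks back along the half-line: [j] counts the steps from [c N] towards [c 0],
   which is [q]. *)
have pole j : (j <= N)%N -> polyapprox K (fun z => (z - c (N - j)%N)^-1).
  elim: j => [_|j IH jN].
    rewrite subn0.
    have cN0 : 0 < normc (c N) by have := normr_ge0 M; lra.
    have cN : c N != 0 by apply/eqP => c0; move: cN0; rewrite c0 normc0 ltxx.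
    apply: (@eq_polyapprox _ (fun z => (- (c N)^-1) / (1 - (c N)^-1 * z))).
      move=> z Kz; have := cK z N Kz; move: (c N) cN => a a0 za; field.
      by rewrite za a0 -opprB oppr_eq0 za.
    apply: (@polyapprox_geometric _ (fun=> - (c N)^-1)
      (fun z => (c N)^-1 * z)); first exact: polyapprox_cst.
      by apply: polyapproxM (polyapprox_cst _ _) (polyapprox_id KM).
    move=> z Kz; rewrite normcM normcV mulrC ler_pdivrMr//.
    by have := KM _ Kz; have := ler_norm M; lra.
  pose k := (N - j.+1)%N; have := IH (ltnW jN).
  have -> : (N - j)%N = k.+1 by rewrite /k subnS prednK// subn_gt0.
  rewrite -/k => Kk.
  (* With w = z - c k.+1, the next function is 1 / (w + s) = w^-1 / (1 + s w^-1), and |s w^-1| <=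
     1/2 because [K] keeps distance 2 s from the poles. *)
  apply: (@eq_polyapprox _
    (fun z => (z - c k.+1)^-1 / (1 - (- s)%:C%C * (z - c k.+1)^-1))).
    move=> z Kz; have := cK z k.+1 Kz; have := cK z k Kz.
    have -> : c k.+1 = c k + s%:C%C.
      by rewrite /c -natr1 mulrDl mul1r rmorphD addrA.
    rewrite rmorphN /= => z1 z2; rewrite mulNr opprK; field.
    by rewrite z1.
  apply: (@polyapprox_geometric _ (fun z => (z - c k.+1)^-1)
    (fun z => (- s)%:C%C * (z - c k.+1)^-1)) => //.
    by apply: polyapproxM => //; exact: polyapprox_cst.
  move=> z Kz; rewrite normcM normcV.
  have -> : normc (- s)%:C%C = s.
    by rewrite /= expr0n addr0 sqrrN sqrtr_sqr gtr0_norm.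
  have := Ks _ Kz k.+1; rewrite -/(c _) => h.
  by rewrite ler_pdivrMr; lra.
rewrite -[q]addr0.
have := pole N (leqnn N); rewrite subnn /c mul0r; exact.
Qed.

(** With q = p + 2 s, the function 2 s / (z - q) is -1 at [p] and at most 1/2 in modulus on [K]. A
    polynomial [Q] within 1/8 of it has |Q(p)| >= 7/8 and |Q| <= 5/8 on [K], so the powers of Q /
    Q(p) decay on [K] with ratio 5/7. *)
Lemma polynomial_separation K (M s e : R) p : 0 < s -> 0 < e ->
  (forall z, K z -> normc z <= M) ->
  (forall z, K z -> forall j : nat,
    4 * s <= normc (z - (p + (j.+2%:R * s)%:C%C))) ->
  exists P : {poly C}, P.[p] = 1 /\ forall z, K z -> normc P.[z] <= e.
Proof.
move=> s0 e0 KM Ks.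
pose q := p + (2 * s)%:C%C.
have qE j : q + (j%:R * s)%:C%C = p + (j.+2%:R * s)%:C%C.
  by rewrite /q -addrA -rmorphD -mulrDl -natrD.
have normR (x : R) : 0 <= x -> normc x%:C%C = x.
  by move=> x0; rewrite /= expr0n addr0 sqrtr_sqr ger0_norm.
(* The approximation must also hold at [p], whose distance to the half-line from [q] is exactly 2
   s. *)
pose K' z := K z \/ z = p.
have [_] : polyapprox K' (fun z => (2 * s)%:C%C * (z - q)^-1).
  apply: (@polyapproxM _ (fun=> (2 * s)%:C%C)); first exact: polyapprox_cst.
  apply: (@polyapprox_pole _ (`|M| + normc p) s) => //.
    move=> z [/KM|->]; first by have := ler_norm M; have := normc_ge0 p; lra.
    by rewrite lerDr.
  move=> z [Kz j|-> j]; rewrite qE; first by have := Ks _ Kz j; lra.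
  rewrite opprD addrA subrr sub0r normcN normR ?mulr_ge0 ?(ltW s0)//.
  by rewrite ler_pM2r// ler_nat.
have e8 : 0 < 8^-1 :> R by lra.
move=> /(_ _ e8)[Q Qe].
have s2 : 0 < 2 * s by lra.
have Qp : 7 / 8 <= normc Q.[p].
  have := Qe p (or_intror erefl).
  rewrite /q opprD addrA subrr sub0r invrN mulrN divff; last first.
    by apply/eqP => /(congr1 (@complex.Re R)) /= /eqP; rewrite gt_eqF.
  by have := le_normcB (-1) Q.[p]; rewrite normcN normc1; lra.
have QK z : K z -> normc Q.[z] <= 5 / 8.
  move=> Kz; have := Qe z (or_introl Kz).
  have : normc ((2 * s)%:C%C * (z - q)^-1) <= 2^-1.
    rewrite normcM normcV normR ?(ltW s2)//.
    have := Ks _ Kz 0%N; rewrite -qE mul0r addr0 => zq.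
    rewrite ler_pdivrMr; lra.
  have := le_normcB Q.[z] ((2 * s)%:C%C * (z - q)^-1).
  by rewrite normcB; lra.
have [|||n ne] := @exprn_eventually_le (5 / 7) e; [lra|lra|done|].
have Qp0 : Q.[p] != 0 by apply/eqP => Q0; move: Qp; rewrite Q0 normc0; lra.
exists ((Q.[p]^-1 *: Q) ^+ n); split.
  by rewrite horner_exp hornerZ mulVf// expr1n.
move=> z Kz; rewrite horner_exp hornerZ normcX normcM normcV.
rewrite (le_trans _ ne)// lerXn2r ?nnegrE ?mulr_ge0 ?invr_ge0 ?normc_ge0//.
by rewrite mulrC ler_pdivrMr; have := QK _ Kz; lra.
Qed.

Lemma pointwise_null_polynomials : exists (P : nat -> {poly C}) (p : nat -> C),
  [/\ forall n, (P n).[p n] = 1,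
      forall e, 0 < e -> exists N, forall n, (N <= n)%N -> normc (p n) <= e &
      forall z e, 0 < e ->
        exists N, forall n, (N <= n)%N -> normc (P n).[z] <= e].
Proof.
pose h n : R := n.+1%:R^-1.
have h0 n : 0 < h n by rewrite invr_gt0.
have hle e : 0 < e -> exists N, forall n, (N <= n)%N -> h n <= e.
  move=> e0; have /archi_boundP eN : 0 <= e^-1 by rewrite invr_ge0 ltW.
  exists (Num.bound e^-1) => n Nn; rewrite -[e]invrK lef_pV2 ?posrE ?invr_gt0//.
  by rewrite (le_trans (ltW eN))// ler_nat leqW.
(* Within the disc of radius n, [K n] leaves out the half-strip 4 h < Im < 8 h, Re > 2 h. The
   half-line to the right of [p n] runs along its middle, at distance at least 2 h from [K n], which
   is 4 s for s = h n / 2. *)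
pose p n : C := (4 * h n +i* (6 * h n))%C.
pose K n z := normc z <= n%:R /\
  [\/ complex.Im z <= 4 * h n, 8 * h n <= complex.Im z |
      complex.Re z <= 2 * h n].
have /choice[P PE] n : exists P : {poly C}, P.[p n] = 1 /\
    forall z, K n z -> normc P.[z] <= h n.
  apply: (@polynomial_separation _ n%:R (h n / 2)) => //.
    by rewrite divr_gt0.
    by move=> z [].
  move=> z [_ Kz] j; set w := z - _.
  have := le_trans (ler_norm _) (le_Re_normc w).
  have := le_trans (ler_norm _) (le_Re_normc (- w)).
  have := le_trans (ler_norm _) (le_Im_normc w).
  have := le_trans (ler_norm _) (le_Im_normc (- w)).
  rewrite normcN {}/w; case: z Kz => a b /= Kz.
  have : 0 <= j.+2%:R * (h n / 2) by rewrite mulr_ge0 ?divr_ge0 ?(ltW (h0 n)).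
  have := h0 n.
  by case: Kz => /=; lra.
exists P, p; split => [n|e e0|z e e0]; first by have [] := PE n.
  (* The real and imaginary parts of [p n] add up to 10 h n. *)
  have [|N Nh] := hle (e / 10); first lra.
  exists N => n /Nh hn; rewrite (le_trans (normc_le_ReIm _))//=.
  by rewrite !ger0_norm; have := h0 n; lra.
have [N1 N1h] := hle _ e0.
have [N2 N2z] : exists N2, normc z <= N2%:R.
  by exists (Num.bound (normc z)); exact: ltW (archi_boundP (normc_ge0 z)).
(* A fixed z avoids all late strips: it lies below every one of them if Im z <= 0, and above them
   once 8 h n <= Im z otherwise. *)
have [N3 N3z] : exists N3, forall n, (N3 <= n)%N ->
    complex.Im z <= 4 * h n \/ 8 * h n <= complex.Im z.
  have [z0|z0] := leP (complex.Im z) 0.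
    by exists 0%N => n _; left; have := h0 n; lra.
  have [|N NE] := hle (complex.Im z / 8); first lra.
  by exists N => n /NE; right; lra.
exists (maxn N1 (maxn N2 N3)) => n; rewrite !geq_max => /and3P[n1 n2 n3].
rewrite (le_trans _ (N1h _ n1))//; have [_] := PE n; apply; split.
  by rewrite (le_trans N2z)// ler_nat.
by case: (N3z _ n3) => ?; [apply: Or31|apply: Or32].
Qed.

End PolynomialApproximation.

(** * Bounded complex sequences *)

Section BoundedSequences.
Context {R : realType}.
Local Notation C := (Cplx R).

Lemma cplx_normE (z : C) : `|z| = (normc z)%:C%C.
Proof. by []. Qed.

(** Norms and radii over [Cplx R] are complex numbers; since the positive ones are real, estimates
    can be carried out in [R]. *)
Lemma cplx_gt0E (e : C) : 0 < e -> exists2 r : R, 0 < r & e = r%:C%C.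
Proof.
case: e => a b; rewrite ltcE /= => /andP[/eqP -> a0]; by exists a.
Qed.

Definition bounded_pred : {pred nat -> C} :=
  [pred a | `[< exists M : R, forall n, normc (a n) <= M >]].

Lemma bounded_submod : submod_closed bounded_pred.
Proof.
split; first by apply/asboolP; exists 0 => n; rewrite normc0.
move=> c a b /asboolP[M aM] /asboolP[N bN]; apply/asboolP.
exists (normc c * M + N) => n; rewrite (le_trans (le_normcD _ _))// lerD//.
by rewrite normcM ler_wpM2l ?normc_ge0.
Qed.

HB.instance Definition _ :=
  GRing.isSubmodClosed.Build _ _ bounded_pred bounded_submod.

Record linf := Linf { linf_fun :> nat -> C; _ : linf_fun \in bounded_pred }.

HB.instance Definition _ := [isSub for linf_fun].
HB.instance Definition _ := [Choice of linf by <:].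
HB.instance Definition _ := [SubChoice_isSubLmodule of linf by <:].

Definition linf_norm (a : linf) : R := sup (range (fun n => normc (a n))).

Lemma linf_bounded (a : linf) : exists M : R, forall n, normc (a n) <= M.
Proof. by case: a => a ha; exact/asboolP. Qed.

Lemma le_linf_norm (a : linf) n : normc (a n) <= linf_norm a.
Proof.
have [M aM] := linf_bounded a.
apply: ub_le_sup; last by exists n.
by exists M => _ [m _ <-]; exact: aM.
Qed.

Lemma linf_norm_le (a : linf) (M : R) :
  (forall n, normc (a n) <= M) -> linf_norm a <= M.
Proof.
move=> aM; apply: ge_sup; first by exists (normc (a 0%N)), 0%N.
by move=> _ [m _ <-]; exact: aM.
Qed.

(** A norm over [Cplx R] takes its values in [Cplx R], whence the cast of the real supremum. *)
Lemma linf_normD (a b : linf) :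
  (linf_norm (a + b))%:C%C <= (linf_norm a)%:C%C + (linf_norm b)%:C%C :> C.
Proof.
rewrite -rmorphD lecR; apply: linf_norm_le => n.
by rewrite (le_trans (le_normcD _ _))// lerD// le_linf_norm.
Qed.

Lemma linf_normZ (c : C) (a : linf) :
  (linf_norm (c *: a))%:C%C = `|c| * (linf_norm a)%:C%C :> C.
Proof.
rewrite cplx_normE -rmorphM; congr (_%:C)%C; apply/eqP; rewrite eq_le.
apply/andP; split.
  apply: linf_norm_le => n.
  by rewrite normcM ler_wpM2l ?normc_ge0// le_linf_norm.
have [->|c0] := eqVneq c 0.
  by rewrite normc0 mul0r (le_trans (normc_ge0 _) (le_linf_norm _ 0)).
have {}c0 : 0 < normc c.
  rewrite lt_neqAle normc_ge0 andbT; apply/eqP => /esym /eq0_normc /eqP.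
  by rewrite (negbTE c0).
rewrite mulrC -ler_pdivlMr//; apply: linf_norm_le => n.
rewrite ler_pdivlMr// mulrC -normcM; exact: (le_linf_norm (c *: a)).
Qed.

Lemma linf_norm_eq0 (a : linf) : (linf_norm a)%:C%C = 0 :> C -> a = 0.
Proof.
case=> a0; apply/val_inj/funext => n; apply/eq0_normc/eqP.
by rewrite eq_le normc_ge0 andbT -a0 le_linf_norm.
Qed.

HB.instance Definition _ := Lmodule_isNormed.Build C linf
  linf_normD linf_normZ linf_norm_eq0.

Lemma linf_normE (a : linf) : `|a| = (linf_norm a)%:C%C :> C.
Proof. by []. Qed.

(** Applied with [p] the real and the imaginary part, this reduces completeness to that of [R]. The
    final bound involves only the radius of a ball lying in [F], hence is uniform in [n]. *)
Lemma linf_coordinate_cvg (p : C -> R) (F : set_system linf) :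
  (forall z w, `|p z - p w| <= normc (z - w)) ->
  ProperFilter F -> cauchy F -> forall n, exists t : R, forall a e, 0 < e ->
    F (ball a e%:C%C) -> `|p (a n) - t| <= e.
Proof.
move=> pL FF /cauchyP Fc n; pose g (a : linf) := p (a n).
have gball a e : F (ball a e%:C%C) -> F [set b | `|g a - g b| < e].
  apply: filterS => b; rewrite -ball_normE /= linf_normE ltcR.
  by apply: le_lt_trans; rewrite (le_trans (pL _ _))// (le_linf_norm (a - b)).
have /cvg_ex[t gt] : cvg (g @ F).
  apply: R_complete; apply: cauchy_exP => e e0.
  have [|a /gball Fa] := Fc e%:C%C; first by rewrite ltcR.
  by exists (g a); near=> b; rewrite -ball_normE /=; near: b.
exists t => a e e0 /gball Fa; apply/ler_addgt0Pr => d d0.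
have /cvgrPdist_lt /(_ d d0) Fd := gt.
near F => b; have hb : `|g a - g b| < e by near: b.
have hd : `|t - g b| < d by near: b.
rewrite -/(g a) -[g a](subrK (g b)) -addrA (le_trans (ler_normD _ _))//.
by rewrite lerD ?ltW// distrC.
Unshelve. all: by end_near. Qed.

Lemma linf_complete (F : set_system linf) :
  ProperFilter F -> cauchy F -> cvg F.
Proof.
move=> FF Fc.
have ReL (z w : C) : `|complex.Re z - complex.Re w| <= normc (z - w).
  by have := le_Re_normc (z - w); case: z; case: w.
have ImL (z w : C) : `|complex.Im z - complex.Im w| <= normc (z - w).
  by have := le_Im_normc (z - w); case: z; case: w.
have /choice[x xP] := linf_coordinate_cvg ReL FF Fc.
have /choice[y yP] := linf_coordinate_cvg ImL FF Fc.
pose l n : C := (x n +i* y n)%C.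
have lP a e n : 0 < e -> F (ball a e%:C%C) -> normc (a n - l n) <= e + e.
  move=> e0 Fa; have := xP n a e e0 Fa; have := yP n a e e0 Fa.
  move=> hy hx; apply: le_trans (normc_le_ReIm _) _; move: hx hy.
  by rewrite /l; case: (a n) => u v hx hy; exact: lerD.
move/cauchyP : (Fc) => Fx.
(* Any [a] whose unit ball lies in [F] is within 2 of [l] at every index. *)
have lB : l \in bounded_pred.
  have [|a Fa] := Fx 1%:C%C; first by rewrite ltcR.
  have [M aM] := linf_bounded a; apply/asboolP; exists (M + 2) => n.
  have := le_normcB (l n) (a n); rewrite normcB.
  by have := lP a 1 n ltr01 Fa; have := aM n; lra.
apply/cvg_ex; exists (Linf lB); apply/cvgrPdist_le => _ /cplx_gt0E[e e0 ->].
(* The limit is within e / 4 + e / 4 of [a] (real and imaginary parts), and [a] is within e / 4 of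
   [b]. *)
have e4 : 0 < e / 4 by lra.
have [|a Fa] := Fx (e / 4)%:C%C; first by rewrite ltcR.
move: (Fa); apply: filterS => b; rewrite -ball_normE /= linf_normE ltcR => ab.
rewrite linf_normE lecR; apply: linf_norm_le => n.
have h1 := lP a _ n e4 Fa; have h2 := le_linf_norm (a - b) n.
have -> : (Linf lB - b) n = (l n - a n) + (a - b) n.
  by rewrite addrA subrK.
by rewrite (le_trans (le_normcD _ _))// normcB; lra.
Qed.

HB.instance Definition _ := Uniform_isComplete.Build linf linf_complete.

(** Expressing the first n + 1 unit sequences in n generators would factor the identity matrix of
    size n + 1 through dimension n, against the rank. *)
Lemma linf_infinite_dimensional : infinite_dimensional linf.
Proof.
move=> [n [e he]].
have dB k : (fun m => (m == k)%:R : C) \in bounded_pred.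
  apply/asboolP; exists 1 => m; case: (m == k); rewrite ?normc1// normc0.
  exact: ler01.
have /choice[c cP] (k : 'I_n.+1) := he (Linf (dB k)).
pose A : 'M[C]_(n.+1, n) := \matrix_(i, j) c i j.
pose B : 'M[C]_(n, n.+1) := \matrix_(i, j) e i j.
have linf_sum (I : finType) (F : I -> linf) m : (\sum_i F i) m = \sum_i F i m.
  by elim/big_rec2: _ => // i u v _ <-.
have AB : A *m B = 1%:M.
  apply/matrixP => i j; rewrite !mxE.
  have /(congr1 (fun a : linf => a j)) := cP i.
  rewrite linf_sum /= => E.
  rewrite -[(i == j)]/(val i == val j) eq_sym E.
  by apply: eq_bigr => k _; rewrite !mxE.
have := mxrankM_maxl A B.
rewrite AB mxrank1 => /leq_trans /(_ (rank_leq_col A)).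
by rewrite ltnn.
Qed.

End BoundedSequences.
Arguments linf R : clear implicits.

(** * Embedding bounded sequences into sequences of holomorphic functions *)

Section HolomorphicFunctions.
Context {R : realType} (Omega : set (Cplx R)).
Local Notation C := (Cplx R).

Lemma uniform_cvg_normcP (T : Type) (F : set_system T) (A : set Omega)
    (g : T -> Omega -> C) (l : Omega -> C) : Filter F ->
  {uniform A, g @ F --> l} <->
  forall e : R, 0 < e ->
    \forall t \near F, forall z, A z -> normc (l z - g t z) <= e.
Proof.
move=> FF; split=> [gl e e0|gl P /uniform_nbhs[E []]].
  have : nbhs (l : {uniform` A -> C})
      [set h | forall z, A z -> ball (l z) e%:C%C (h z)].
    apply/uniform_nbhs; exists [set xy | ball xy.1 e%:C%C xy.2]; split=> //.
    have e0C : 0 < e%:C%C :> C by rewrite ltcR.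
    exact: (entourage_ball _ (PosNum e0C)).
  move=> /gl glE.
  have {glE} : F [set t | forall z, A z -> ball (l z) e%:C%C (g t z)].
    exact: glE.
  apply: filterS => t h z /h; rewrite -ball_normE /= cplx_normE ltcR.
  exact: ltW.
rewrite -entourage_ballE => -[_ /cplx_gt0E[e e0 ->] eE] EP.
have e20 : 0 < e / 2 by lra.
apply: filterS (gl _ e20) => t gt; apply: EP => z /gt zt; apply: eE.
by rewrite /= -ball_normE /= cplx_normE ltcR; lra.
Qed.

Lemma uniform_cvg0P (A : set Omega) (f : nat -> Hol Omega) :
  {uniform A, (fun n => hol_fun (f n)) @ \oo --> cst 0} <->
  forall e : R, 0 < e ->
    \forall n \near \oo, forall z, A z -> normc (f n z) <= e.
Proof.
rewrite uniform_cvg_normcP; split=> fe e /fe; apply: filterS => n h z /h;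
  by rewrite sub0r normcN.
Qed.

(** As [Omega] is open, the extension by 0 of the restriction agrees with [h] near each of its
    points. *)
Lemma sigL_holomorphic (h : C -> C) : open Omega ->
  (forall z, Omega z -> derivable h z 1) ->
  (sigL Omega h : Omega -> C) \in @holo_pred R Omega.
Proof.
move=> oO dh; apply/asboolP => z.
have Oz : Omega (\val z) by case: z => z /= /set_mem.
apply: near_eq_derivable (dh _ Oz); near=> w.
have Ow : Omega w by near: w; exact: open_nbhs_nbhs.
have := congr1 (fun k => k h w) (@sigLK _ _ (0 : C) Omega).
by rewrite /= => ->; rewrite patchT// inE.
Unshelve. all: by end_near. Qed.

Lemma Hol_continuous (f : Hol Omega) : continuous (f : Omega -> C).
Proof.
move=> z; have -> : (f : Omega -> C) = 'valL_ 0 f \o set_val.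
  by rewrite -[LHS](@valLK _ _ (0 : C) Omega).
apply: continuous_comp; first exact: initial_continuous.
apply/differentiable_continuous/derivable1_diffP.
by case: f => f /= /asboolP; exact.
Qed.

(** Continuity gives |f| <= |f x| + 1 near x; compactness, in its covering form along n -> oo,
    merges these local bounds into one integer bound. *)
Lemma Hol_bounded (f : Hol Omega) (K : set Omega) : compact K ->
  exists M : R, forall z, K z -> normc (f z) <= M.
Proof.
move=> /compact_near_coveringP /(_ nat \oo
  (fun n z => normc (f z) <= n%:R) _) [].
  move=> x _; near=> y n => /=.
  have : `|f x - f y| <= 1.
    by near: y; apply: (cvgrPdist_le _ _).1 => //; exact: Hol_continuous.
  rewrite cplx_normE lecR => xy.
  have : normc (f x) + 1 <= n%:R by near: n; exact: nbhs_infty_ger.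
  by have := le_normcB (f y) (f x); rewrite normcB; lra.
by move=> n _ /(_ n (leqnn _)) Kn; exists n%:R.
Unshelve. all: by end_near. Qed.

(** The fibres, where n + 1 is 2^k times an odd number, are the infinite blocks of indices that
    share a coefficient. *)
Definition block (n : nat) := logn 2 n.+1.

Lemma block_infinite k N : exists2 n, (N <= n)%N & block n = k.
Proof.
(* The odd factor 2 N + 1 keeps the valuation of n + 1 equal to k and pushes n beyond N. *)
exists (2 ^ k * N.*2.+1).-1%N.
  have : (0 < 2 ^ k)%N by rewrite expn_gt0.
  case: (2 ^ k)%N => // m _; rewrite mulSn /= -addnn -addnA leq_addr.
  done.
rewrite /block prednK ?muln_gt0 ?expn_gt0//.
rewrite lognM ?expn_gt0// pfactorK// logn_coprime ?addn0//.
by rewrite coprime2n /= odd_double.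
Qed.

Variable f : nat -> Hol Omega.

Definition linf_embed (a : linf R) : nat -> Hol Omega :=
  fun n => a (block n) *: f n.

Lemma linf_embed_is_linear : linear linf_embed.
Proof.
move=> c a b; apply/funext => n.
by rewrite /linf_embed !fctE /= scalerDl scalerA.
Qed.

HB.instance Definition _ := GRing.isLinear.Build C (linf R) (nat -> Hol Omega) _
  linf_embed linf_embed_is_linear.

Lemma linf_embed_inj : (forall n, f n != 0) -> injective linf_embed.
Proof.
move=> f0 a b /(congr1 (fun u => u - linf_embed b)).
rewrite subrr -raddfB => ab0; apply/eqP; rewrite -subr_eq0; apply/eqP.
apply/val_inj/funext => k; have [n _ <-] := block_infinite k 0.
have /(congr1 (fun u => u n)) := ab0; rewrite /linf_embed /= => /eqP.
by rewrite scaler_eq0 (negbTE (f0 n)) orbF => /eqP.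
Qed.

(** The topology of the target is tested at one index n and on one compact set at a time; there a
    bound of [f n] turns the norm of a - b into a uniform estimate. *)
Lemma linf_embed_continuous :
  continuous (linf_embed : linf R -> {ptws nat -> Hol Omega}).
Proof.
suff cf n (a : linf R) : hol_fun (linf_embed b n) @[b --> a] -->
    (hol_fun (linf_embed a n) : {family compact, Omega -> C}).
  move=> a; have Fa : Filter (nbhs (a : linf R)) by exact: nbhs_filter.
  apply/cvg_sup => n.
  apply: (@continuous_comp_initial _ (linf R) (Hol Omega) (fun u => u n)
    linf_embed).
  apply: (@continuous_comp_initial _ (linf R) {family compact, Omega -> C}
    (@hol_fun _ Omega)); exact: cf.
have Fa : Filter (nbhs a) by exact: nbhs_filter.
apply/fam_cvgP => K cK; apply/uniform_cvg_normcP => e e0.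
have [M fM] := Hol_bounded (f n) cK; have M0 := normr_ge0 M.
have M1 : 0 < `|M| + 1 by lra.
have : \forall b \near a, `|a - b| <= (e / (`|M| + 1))%:C%C.
  apply/nbhs_ballP; exists (e / (`|M| + 1))%:C%C.
    by rewrite /= ltcR divr_gt0.
  by move=> b; rewrite -ball_normE /=; exact: ltW.
apply: filterS => b ab z /fM fz.
rewrite linf_normE lecR in ab.
have -> : hol_fun (linf_embed a n) z - hol_fun (linf_embed b n) z =
    (a - b) (block n) * f n z by rewrite mulrBl.
rewrite normcM (@le_trans _ _ (e / (`|M| + 1) * (`|M| + 1)))//.
  rewrite ler_pM ?normc_ge0//; first exact: le_trans (le_linf_norm _ _) ab.
  by have := ler_norm M; lra.
by rewrite divfK ?gt_eqF.
Qed.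

Lemma linf_embed_uniform_cvg (A : set Omega) (a : linf R) :
  {uniform A, (fun n => hol_fun (f n)) @ \oo --> cst 0} ->
  {uniform A, (fun n => hol_fun (linf_embed a n)) @ \oo --> cst 0}.
Proof.
move=> /uniform_cvg0P fA; apply/uniform_cvg0P => e e0.
(* Adding 1 avoids a division by 0 when [a] is zero. *)
have M0 : 0 < linf_norm a + 1.
  by have := le_trans (normc_ge0 _) (le_linf_norm a 0); lra.
apply: filterS (fA _ (divr_gt0 e0 M0)) => n fn z /fn fz.
have an := le_linf_norm a (block n).
have -> : linf_embed a n z = a (block n) * f n z by [].
rewrite normcM (@le_trans _ _ ((linf_norm a + 1) * (e / (linf_norm a + 1))))//.
  by rewrite ler_pM ?normc_ge0//; lra.
by rewrite mulrC divfK ?gt_eqF.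
Qed.

Lemma linf_embed_uniform_ncvg (A : set Omega) (a : linf R) :
  (forall n, exists2 z, A z & 1 <= normc (f n z)) -> a != 0 ->
  ~ {uniform A, (fun n => hol_fun (linf_embed a n)) @ \oo --> cst 0}.
Proof.
move=> f1 a0 /uniform_cvg0P aA.
have [k ak] : exists k, a k != 0.
  apply/not_existsP => ak; case/eqP: a0; apply/val_inj/funext => k.
  by apply/eqP/negPn/negP/ak.
have {}ak : 0 < normc (a k).
  rewrite lt_neqAle normc_ge0 andbT; apply/eqP => /esym /eq0_normc /eqP.
  by rewrite (negbTE ak).
(* For each index of block [k], some point of [A] makes the product at least |a k|, twice this
   tolerance. *)
have [|N _ NE] := aA (normc (a k) / 2); first by lra.
have [n Nn nk] := block_infinite k N.
have [z Az fz] := f1 n; have := NE n Nn z Az.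
have -> : linf_embed a n z = a (block n) * f n z by [].
by rewrite nk normcM; nra.
Qed.

End HolomorphicFunctions.

(** * The Banach space attached to a model sequence *)

Section LinfSpace.
Context {R : realType} (Omega : set (Cplx R)).
Local Notation C := (Cplx R).
Variables (f : nat -> Hol Omega) (f_neq0 : forall n, f n != 0).

Definition linf_space : banachSubspace (nat -> Hol Omega) :=
  BanachSubspace (linf_embed_inj f_neq0).

Lemma linf_space_finer : finer_than_inherited linf_space.
Proof.
move=> A [B oB <-].
by have /continuousP := @linf_embed_continuous R Omega f; exact.
Qed.

Lemma linf_space_infinite_dimensional : infinite_dimensional linf_space.
Proof. exact: (@linf_infinite_dimensional R). Qed.

Lemma linf_space_carrier g : (carrier linf_space `\ 0) g ->
  exists2 a, a != 0 & g = linf_embed f a.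
Proof.
move=> [[a _ <-] /= a0]; exists a => //.
by apply/eqP => aE; apply: a0; rewrite aE raddf0.
Qed.

Lemma linf_space_Sp : S_p Omega f -> carrier linf_space `\ 0 `<=` S_p Omega.
Proof.
move=> fp _ /linf_space_carrier[a _ ->] z.
(* Convergence at z is treated as uniform convergence on the singleton of z. *)
have /(linf_embed_uniform_cvg a) :
    {uniform [set z], (fun n => hol_fun (f n)) @ \oo --> cst 0}.
  by rewrite uniform_set1; exact: fp.
by rewrite uniform_set1.
Qed.

Lemma linf_space_Suc : S_uc Omega f -> carrier linf_space `\ 0 `<=` S_uc Omega.
Proof.
move=> fp _ /linf_space_carrier[a _ ->] K cK.
exact: linf_embed_uniform_cvg (fp K cK).
Qed.

Lemma linf_space_ncvg (A : set Omega) g :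
  (forall n, exists2 z, A z & 1 <= normc (f n z)) ->
  (carrier linf_space `\ 0) g ->
  ~ {uniform A, (fun n => hol_fun (g n)) @ \oo --> cst 0}.
Proof.
by move=> f1 /linf_space_carrier[a a0 ->]; exact: linf_embed_uniform_ncvg.
Qed.

End LinfSpace.

(** A neighbourhood of the limit absorbs all but finitely many terms, and the remaining ones form a
    finite set. *)
Lemma compact_cvg_range (T : topologicalType) (u : nat -> T) (l : T) :
  u @ \oo --> l -> compact (l |` range u).
Proof.
move=> ul; apply/compact_near_coveringP => I F P FF KP.
have [[U G] /= [lU FG] UGP] := KP l (or_introl erefl).
have [N _ NU] := ul _ lU.
have /compact_near_coveringP /(_ _ _ P FF) := finite_compact
  (finite_image u (finite_II N)).
have uP x : (u @` `I_N) x -> \forall x' \near x & i \near F, P i x'.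
  by move=> [n _ <-]; apply: KP; right; exists n.
move=> /(_ uP) NP; near=> i => x [->|[n _ <-]].
  apply: (UGP (l, i)); split => /=; first exact: nbhs_singleton.
  by near: i.
have [nN|Nn] := ltnP n N.
  have : u @` `I_N `<=` P i by near: i.
  by apply; exists n.
apply: (UGP (u n, i)); split => /=; first exact: NU.
by near: i.
Unshelve. all: by end_near. Qed.

(** * Two model sequences *)

(* [derive.derivable_horner] covers real fields only. *)
Lemma derivable_horner_numField (K : numFieldType) (p : {poly K}) (x : K) :
  derivable (horner p) x 1.
Proof.
elim/poly_ind: p => [|p c IH].
  rewrite (_ : horner 0 = cst 0); first exact: derivable_cst.
  by apply/funext => y; rewrite horner0.
have -> : horner (p * 'X + c%:P) = horner p * id + cst c.
  by apply/funext => y; rewrite hornerMXaddC.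
apply: derivableD; last exact: derivable_cst.
by apply: derivableM => //; exact: derivable_id.
Qed.

Lemma cvg_subtype_normc (R : realType) (Omega : set (Cplx R))
    (v : nat -> Omega) (l : Omega) :
  (forall e : R, 0 < e -> exists N, forall n, (N <= n)%N ->
    normc (\val (v n) - \val l : Cplx R) <= e) ->
  v @ \oo --> l.
Proof.
move=> vl U [_ [[W oW <-] /= Wl WU]].
have /nbhs_ballP[_ /cplx_gt0E[e e0 ->] eW] : nbhs (\val l) W.
  exact: open_nbhs_nbhs.
have e20 : 0 < e / 2 by lra.
have [N NP] := vl _ e20; exists N => // n /NP vn; apply: WU; apply: eW.
by rewrite -ball_normE /= distrC cplx_normE ltcR; lra.
Qed.

Section Examples.
Context {R : realType} (Omega : set (Cplx R)).
Local Notation C := (Cplx R).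
Hypotheses (Omega_open : open Omega) (Omega_neq0 : Omega !=set0).

Lemma Omega_normc_ball z : Omega z -> exists2 e : R, 0 < e &
  forall w : C, normc (w - z) < e -> Omega w.
Proof.
move=> Oz; have /nbhs_ballP[_ /cplx_gt0E[e e0 ->] eO] : nbhs z Omega.
  exact: open_nbhs_nbhs.
exists e => // w wz; apply: eO.
by rewrite -ball_normE /= distrC cplx_normE ltcR.
Qed.

Lemma exists_unbounded_Hol : exists g : Hol Omega,
  forall M : R, exists z, M <= normc (g z).
Proof.
have [Oinf|] := pselect (forall M : R, exists2 z, Omega z & M <= normc z).
  have idH : (sigL Omega id : Omega -> C) \in @holo_pred R Omega.
    by apply: sigL_holomorphic => // z _; exact: derivable_id.
  exists (MkHol idH) => M; have [z Oz zM] := Oinf M.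
  by exists (SigSub (mem_set Oz)).
move=> /existsNP[M OM]; have {}OM z : Omega z -> normc z < M.
  by move=> Oz; rewrite ltNge; apply/negP => Mz; apply: OM; exists z.
have [z0 Oz0] := Omega_neq0.
(* The boundary point is where the horizontal ray [c] first leaves [Omega]: [S] collects the times
   up to which the ray stays inside, and its supremum [b] is the exit time. *)
pose c (t : R) : C := z0 + t%:C%C.
have cB s t : normc (c s - c t) = `|s - t|.
  rewrite /c opprD addrACA subrr add0r -rmorphB /=.
  by rewrite expr0n addr0 sqrtr_sqr.
pose S := [set t : R | 0 <= t /\ forall s, 0 <= s <= t -> Omega (c s)].
have c0 : c 0 = z0 by rewrite /c addr0.
have S0 : S 0 by split=> // s /le_anti <-; rewrite c0.
have S_sup : has_sup S.
  split; first by exists 0.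
  exists (M + normc z0) => t [t0 /(_ t)]; rewrite t0 lexx => /(_ isT) /OM ctM.
  have := cB t 0; rewrite c0 subr0 ger0_norm// => <-.
  by have := le_normcD (c t) (- z0); rewrite normcN; lra.
pose b := sup S.
have b0 : 0 <= b by exact: ub_le_sup S_sup.2 _ S0.
have bO : ~ Omega (c b).
  (* If [c b] were in [Omega], openness would keep the ray inside up to time b + e / 2. *)
  move=> /Omega_normc_ball[e e0 eO].
  suff : S (b + e / 2) by move=> /(ub_le_sup S_sup.2); rewrite -/b; lra.
  split=> [|s /andP[s0 sb]]; first by lra.
  have [bs|sb'] := leP (b - e / 2) s.
    by apply: eO; rewrite cB ltr_norml; lra.
  have [t [_ tS] st] : exists2 t, S t & s < t.
    by apply/sup_gt; [exists 0|rewrite -/b; lra].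
  by apply: tS; rewrite s0 ltW.
have gH : (sigL Omega (fun z => (z - c b)^-1) : Omega -> C)
    \in @holo_pred R Omega.
  apply: sigL_holomorphic => // z Oz.
  apply: (@derivableV _ _ (fun z => z - c b)).
    by apply/eqP => /subr0_eq zb; apply: bO; rewrite -zb.
  by apply: derivableB; [exact: derivable_id|exact: derivable_cst].
exists (MkHol gH) => N; have N0 := normr_ge0 N.
(* At a time t < b with b - t < d, the modulus 1 / (b - t) exceeds |N| + 1. *)
pose d := (`|N| + 1)^-1; have d0 : 0 < d by rewrite invr_gt0; lra.
have [t St bt] : exists2 t, S t & b - d < t.
  by apply/sup_gt; [exists 0|rewrite -/b; lra].
have Ot : Omega (c t) by apply: St.2; rewrite St.1 lexx.
exists (SigSub (mem_set Ot)); rewrite /= normcV cB.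
have tb : t <= b by exact: ub_le_sup S_sup.2 _ St.
have {}tb : t < b.
  by rewrite lt_neqAle tb andbT; apply/eqP => tE; apply: bO; rewrite -tE.
rewrite distrC gtr0_norm ?subr_gt0//.
apply: (@le_trans _ _ d^-1); first by rewrite invrK; have := ler_norm N; lra.
by rewrite lef_pV2 ?posrE ?subr_gt0//; lra.
Qed.

Lemma exists_Sp_not_Suc : exists (f : nat -> Hol Omega) (K : set Omega),
  [/\ S_p Omega f, compact K & forall n, exists2 z, K z & 1 <= normc (f n z)].
Proof.
have [z0 Oz0] := Omega_neq0; have [e e0 eO] := Omega_normc_ball Oz0.
have [P [p [Pp p0 P0]]] := @pointwise_null_polynomials R.
have e20 : 0 < e / 2 by lra.
(* Dropping the first [N] terms puts all the points z0 + p n in a ball around z0 contained in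
   [Omega]. *)
have [N pN] := p0 _ e20.
have pO n : z0 + p (N + n)%N \in Omega.
  apply/mem_set/eO; rewrite addrC addKr.
  by have := pN _ (leq_addr n N); lra.
pose v n : Omega := SigSub (pO n); pose l : Omega := SigSub (mem_set Oz0).
have vl : v @ \oo --> l.
  apply: cvg_subtype_normc => d /p0[M pM]; exists M => n Mn /=.
  by rewrite addrC addKr pM// (leq_trans Mn) ?leq_addl.
(* After translation by z0, the points where the polynomials equal 1 tend to z0, which lies in
   [Omega]; together with z0 they form the compact set. *)
pose Q n : {poly C} := (P (N + n)%N : {poly C}) \Po ('X - z0%:P).
have QH n : (sigL Omega (horner (Q n)) : Omega -> C) \in @holo_pred R Omega.
  by apply: sigL_holomorphic => // z _; exact: derivable_horner_numField.
have QE n (z : Omega) : MkHol (QH n) z = (P (N + n)%N).[\val z - z0].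
  by rewrite /= horner_comp !hornerE.
exists (fun n => MkHol (QH n)), (l |` range v); split => [z||n].
- apply/cvgrPdist_le => _ /cplx_gt0E[d d0 ->].
  have [M PM] := P0 (\val z - z0) d d0.
  exists M => // n Mn; rewrite sub0r normrN cplx_normE lecR.
  by have := PM _ (leq_trans Mn (leq_addl N n)); rewrite -QE.
- exact: compact_cvg_range.
- exists (v n); first by right; exists n.
  by rewrite QE /= addrC addKr Pp normc1.
Qed.

Lemma exists_Suc_not_Su : exists f : nat -> Hol Omega,
  S_uc Omega f /\ forall n, exists z, 1 <= normc (f n z).
Proof.
have [g gM] := exists_unbounded_Hol.
exists (fun n => (n.+1%:R^-1 : C) *: g); split=> [K cK|n].
  have [M KM] := Hol_bounded g cK; have M0 := normr_ge0 M.
  apply/uniform_cvg0P => e e0; near=> n => z /KM gz.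
  have -> : (n.+1%:R^-1 *: g : Hol Omega) z = n.+1%:R^-1 * g z by [].
  rewrite normcM normcV.
  rewrite normc_nat.
  rewrite mulrC ler_pdivrMr//.
  have : `|M| / e <= n%:R by near: n; exact: nbhs_infty_ger.
  rewrite ler_pdivrMr// mulrC; have := ler_norm M; rewrite -natr1 mulrDr; lra.
have [z gz] := gM n.+1%:R; exists z.
have -> : (n.+1%:R^-1 *: g : Hol Omega) z = n.+1%:R^-1 * g z by [].
rewrite normcM normcV.
by rewrite normc_nat mulrC ler_pdivlMr// mul1r.
Unshelve. all: by end_near. Qed.

End Examples.

Theorem theorem5p1 (R : realType) (Omega : set (Cplx R))
    (Omega_open : open Omega) (Omega_neq0 : Omega !=set0) :
  exists X1 X2 : banachSubspace (nat -> Hol Omega),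
    [/\ infinite_dimensional X1 /\ infinite_dimensional X2,
        finer_than_inherited X1 /\ finer_than_inherited X2,
        carrier X1 `\ 0 `<=` S_p Omega `\` S_uc Omega &
        carrier X2 `\ 0 `<=` S_uc Omega `\` S_u Omega].
Proof.
(* Reaching modulus 1 makes every term nonzero, as the injectivity of the embedding requires. *)
have neq0 (f : nat -> Hol Omega) (A : set Omega) :
    (forall n, exists2 z, A z & 1 <= normc (f n z)) -> forall n, f n != 0.
  move=> f1 n; have [z _ fz] := f1 n; apply/eqP => f0.
  by move: fz; rewrite f0 normc0 ler10.
have [f [K [fp cK fK]]] := exists_Sp_not_Suc Omega_open Omega_neq0.
have [g [gc g1]] := exists_Suc_not_Su Omega_open Omega_neq0.
have gT n : exists2 z, [set: Omega] z & 1 <= normc (g n z).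
  by have [z ?] := g1 n; exists z.
exists (linf_space (neq0 _ _ fK)), (linf_space (neq0 _ _ gT)); split.
- by split; exact: linf_space_infinite_dimensional.
- by split; exact: linf_space_finer.
- move=> u Xu; split; first exact: linf_space_Sp Xu.
  by move=> /(_ K cK); exact: linf_space_ncvg Xu.
- move=> u Xu; split; first exact: linf_space_Suc Xu.
  exact: linf_space_ncvg Xu.
Qed.
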